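(* Let $F$ be $\mathbb R$ or $\mathbb C$ and let $*_\mu$ be a multiplication on the space $\mathfrak C$ of $m\times m\times m$ cubic matrices over $F$. Suppose $\mathcal M^{[s,t]}=\left(M^{[s,t]}_{ijk}\right)_{i,j,k=1}^m$ generates a flow of algebras (FA) of type $\mu$, and that the partial derivatives $\frac{\partial}{\partial s}\mathcal M^{[s,t]}$ and $\frac{\partial}{\partial t}\mathcal M^{[s,t]}$ exist for all $0\le s<t$. Then for all $0\le s<\tau<t$, $$\frac{\partial}{\partial s}\mathcal M^{[s,t]}=\left(\frac{\partial}{\partial s}\mathcal M^{[s,\tau]}\right)*_\mu\mathcal M^{[\tau,t]}$$ and $$\frac{\partial}{\partial t}\mathcal M^{[s,t]}=\mathcal M^{[s,\tau]}*_\mu\left(\frac{\partial}{\partial t}\mathcal M^{[\tau,t]}\right).$$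
   Context: A cubic matrix over $F$ is an array $Q=(q_{ijk})_{i,j,k=1}^m$ with entries in $F$; $\mathfrak C$ is the $m^3$-dimensional $F$-vector space of all of them (entrywise operations). A multiplication $*_\mu$ on $\mathfrak C$ is an arbitrary $F$-bilinear map $\mathfrak C\times\mathfrak C\to\mathfrak C$. A family of cubic matrices $\mathcal M^{[s,t]}$, $0\le s\le t$ real, generates an FA (flow of algebras) of type $\mu$ if it satisfies the Kolmogorov-Chapman equation $\mathcal M^{[s,t]}=\mathcal M^{[s,\tau]}*_\mu\mathcal M^{[\tau,t]}$ for all $0\le s<\tau<t$; the FA is the family of $m$-dimensional algebras over $F$ having $\mathcal M^{[s,t]}$ as matrices of structural constants. Partial derivatives are taken entrywise: $\frac{\partial}{\partial s}\mathcal M^{[s,t]}=\left(\frac{\partial}{\partial s}M^{[s,t]}_{ijk}\right)_{i,j,k=1}^m$ (one-sided at $s=0$), and similarly for $t$. *)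

(* Defs.v *)
From HB Require Import structures.
From mathcomp Require Import all_boot all_order all_algebra.
From mathcomp Require Import sesquilinear complex.
From mathcomp Require Import all_classical all_reals all_analysis.

Set Implicit Arguments.
Unset Strict Implicit.
Unset Printing Implicit Defensive.

Import Order.TTheory GRing.Theory Num.Theory.
Import numFieldNormedType.Exports.

Local Open Scope classical_set_scope.
Local Open Scope ring_scope.

Inductive scalars := RealScalars | ComplexScalars.

Definition base_field (R : realType) (K : scalars) : numFieldType :=
  match K with
  | RealScalars => R
  | ComplexScalars => R[i]
  end.

Definition of_real (R : realType) (K : scalars) : R -> base_field R K :=
  match K with
  | RealScalars => fun x => x
  | ComplexScalars => fun x => real_complex R x
  end.

(* Difference quotient of an F-valued function of a real variable. The
   library's [derive] would need a normed R-module structure on the codomain,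
   which R[i], normed over itself, does not have. *)
Definition diff_quot (R : realType) (K : scalars)
    (f : R -> base_field R K) (x h : R) : base_field R K :=
  (of_real K h)^-1 * (f (x + h) - f x).

(* Derivatives relative to a domain D: the limit is over h -> 0, h != 0, with
   x + h in D. It is two-sided when x is interior to D, one-sided when x is an
   endpoint of the interval D. *)
Definition derivable_in (R : realType) (K : scalars)
    (D : set R) (f : R -> base_field R K) (x : R) : Prop :=
  cvg (diff_quot f x h @[h --> within [set h | D (x + h)] 0^']).

Definition derive_in (R : realType) (K : scalars)
    (D : set R) (f : R -> base_field R K) (x : R) : base_field R K :=
  lim (diff_quot f x h @[h --> within [set h | D (x + h)] 0^']).

(* The regular module F^o makes this an F-vector space for the entrywise
   operations. *)
Definition cubic (F : numFieldType) (m : nat) :=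
  {ffun 'I_m * 'I_m * 'I_m -> F^o}.

(* Families are total functions of (s, t), but only the values at
   0 <= s <= t are meaningful, and only those are ever inspected. *)
Definition cubic_family (R : realType) (K : scalars) (m : nat) :=
  R -> R -> cubic (base_field R K) m.

Definition generates_FA (R : realType) (K : scalars) (m : nat)
    (mu : cubic (base_field R K) m -> cubic (base_field R K) m -> cubic (base_field R K) m)
    (M : cubic_family R K m) : Prop :=
  forall s tau t : R, 0 <= s -> s < tau -> tau < t ->
    M s t = mu (M s tau) (M tau t).

Definition s_derivable (R : realType) (K : scalars) (m : nat)
    (M : cubic_family R K m) (s t : R) : Prop :=
  forall ijk, derivable_in `[0, t] (fun u => M u t ijk) s.

Definition t_derivable (R : realType) (K : scalars) (m : nat)
    (M : cubic_family R K m) (s t : R) : Prop :=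
  forall ijk, derivable_in `[s, +oo[ (fun u => M s u ijk) t.

Definition partial_s (R : realType) (K : scalars) (m : nat)
    (M : cubic_family R K m) (s t : R) : cubic (base_field R K) m :=
  [ffun ijk => derive_in `[0, t] (fun u => M u t ijk) s].

Definition partial_t (R : realType) (K : scalars) (m : nat)
    (M : cubic_family R K m) (s t : R) : cubic (base_field R K) m :=
  [ffun ijk => derive_in `[s, +oo[ (fun u => M s u ijk) t].

(* Main.v *)
(* Fix tau. Near s the Kolmogorov-Chapman equation says that M^[u,t] is the
   image of M^[u,tau] under the linear map X |-> mu X M^[tau,t]; near t,
   M^[s,u] is the image of M^[tau,u] under Y |-> mu M^[s,tau] Y. In finite
   dimension every entry of a linear image is a fixed linear combination of the
   entries of the argument, so it commutes with limits of difference
   quotients. *)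
Require Import Defs.
From HB Require Import structures.
From mathcomp Require Import all_boot all_order all_algebra.
From mathcomp Require Import sesquilinear complex.
From mathcomp Require Import all_classical all_reals all_analysis.

Import Order.TTheory GRing.Theory Num.Theory.
Local Open Scope ring_scope.

Import numFieldNormedType.Exports.
Local Open Scope classical_set_scope.

(** Expanding [v] in the basis of matrix units turns each entry of [phi v] into a finite sum with
    constant coefficients, so only limits of scalars are needed later. *)
Lemma linear_cubicE (F : numFieldType) (m : nat)
    (phi : {linear cubic F m -> cubic F m}) (v : cubic F m) ijk :
  phi v ijk = \sum_e v e * phi [ffun e' => (e' == e)%:R] ijk.
Proof.
have {1}-> : v = \sum_e v e *: ([ffun e' => (e' == e)%:R] : cubic F m).
  apply/ffunP => e; rewrite sum_ffunE (bigD1 e) //= big1 => [|e' ne'e].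
    by rewrite !ffunE eqxx addr0 [RHS]mulr1.
  by rewrite !ffunE eq_sym (negbTE ne'e) scaler0.
rewrite linear_sum sum_ffunE; apply: eq_bigr => e _.
by rewrite linearZ ffunE.
Qed.

Lemma diff_quot_linear (R : realType) (K : scalars) (m : nat)
    (phi : {linear cubic (base_field R K) m -> cubic (base_field R K) m})
    (f : R -> cubic (base_field R K) m) (x h : R) ijk :
  diff_quot (fun u => phi (f u) ijk) x h =
  \sum_e diff_quot (fun u => f u e) x h * phi [ffun e' => (e' == e)%:R] ijk.
Proof.
rewrite /diff_quot (linear_cubicE _ _ phi (f (x + h))).
rewrite (linear_cubicE _ _ phi (f x)) -sumrB mulr_sumr.
by apply: eq_bigr => e _; rewrite -mulrBl mulrA.
Qed.

(** Properness makes the limit defining [derive_in] unique. Points of [D] to the right of [x]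
    suffice, which covers the endpoint [s = 0]. *)
Lemma within_dnbhs_proper (R : realType) (D : set R) (x : R) :
  (\forall u \near x^'+, D u) ->
  ProperFilter (within [set h | D (x + h)] 0^').
Proof.
move=> [e e0 De]; apply: Build_ProperFilter_ex => A [e' e'0 Ae'].
(* Half the smaller radius: [h] is nonzero, lies in the ball defining [A], and keeps [x + h] in
   [D]. *)
pose h := Num.min e e' / 2.
have m0 : 0 < Num.min e e' by rewrite lt_min e0 e'0.
have h0 : 0 < h by rewrite divr_gt0.
have hlt : h < Num.min e e' by rewrite ltr_pdivrMr// ltr_pMr// ltr1n.
move: hlt; rewrite lt_min => /andP[he he'].
exists h; apply: Ae'.
- by rewrite /ball_ /= sub0r normrN gtr0_norm.
- by rewrite gt_eqF.
apply: De => /=; last by rewrite ltrDl.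
by rewrite opprD addrA subrr sub0r normrN gtr0_norm.
Qed.

(** Two domains occur because [f] and [g] are differentiated over different intervals; the identity
    between them is asked only near [x] and inside [D2]. *)
Lemma derive_in_linear (R : realType) (K : scalars) (m : nat)
    (phi : {linear cubic (base_field R K) m -> cubic (base_field R K) m})
    (D1 D2 : set R) (f g : R -> cubic (base_field R K) m) (x : R) :
  D2 x -> (\forall u \near x^'+, D2 u) ->
  (\forall u \near x, D2 u -> D1 u /\ g u = phi (f u)) ->
  (forall e, derivable_in D1 (fun u => f u e) x) ->
  [ffun ijk => derive_in D2 (fun u => g u ijk) x] =
  phi [ffun ijk => derive_in D1 (fun u => f u ijk) x].
Proof.
move=> D2x D2r D2D1 df; apply/ffunP => ijk.
have [_ gx] := nbhs_singleton D2D1 D2x.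
have PF := within_dnbhs_proper _ _ _ D2r.
have D2D1h : \forall h \near 0^', D2 (x + h) ->
    D1 (x + h) /\ g (x + h) = phi (f (x + h)).
  apply: nbhs_dnbhs.
  by apply/(nbhs0P (fun u => D2 u -> D1 u /\ g u = phi (f u))).
rewrite ffunE linear_cubicE; apply: cvg_lim; first exact: norm_hausdorff.
(* Near [x] the set [D2] lies in [D1], so a limit along [D1] is also a limit along [D2]. *)
have W : within [set h | D2 (x + h)] 0^' `=>` within [set h | D1 (x + h)] 0^'.
  move=> A; rewrite /within /= => AD1.
  by apply: filterS2 D2D1h AD1 => h D21 D1A /D21[/D1A].
have E : \forall h \near within [set h | D2 (x + h)] 0^',
    diff_quot (fun u => phi (f u) ijk) x h = diff_quot (fun u => g u ijk) x h.
  rewrite /within /=; apply: filterS D2D1h => h D21 /D21[_].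
  by rewrite /diff_quot gx => ->.
apply: cvg_trans (near_eq_cvg E) _.
under eq_cvg do rewrite diff_quot_linear.
apply: cvg_big => [|e _]; first exact: add_continuous.
rewrite ffunE; apply: cvgMl.
(* [df e] unfolds to convergence to [lim], that is, to [derive_in D1]. *)
exact: cvg_trans (cvg_app _ W) (df e).
Qed.

Theorem theorem7 (R : realType) (K : scalars) (m : nat)
    (mu : {bilinear cubic (base_field R K) m -> cubic (base_field R K) m ->
                    cubic (base_field R K) m})
    (M : cubic_family R K m) :
  generates_FA mu M ->
  (forall s t : R, 0 <= s -> s < t -> s_derivable M s t /\ t_derivable M s t) ->
  forall s tau t : R, 0 <= s -> s < tau -> tau < t ->
    partial_s M s t = mu (partial_s M s tau) (M tau t) /\
    partial_t M s t = mu (M s tau) (partial_t M tau t).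
Proof.
move=> FA dM s tau t s0 st tt; split.
- apply: (derive_in_linear _ _ _ (applyr mu (M tau t)) `[0, tau] `[0, t]
    (fun u => M u tau) (fun u => M u t)).
  + by rewrite /= in_itv /= s0 (ltW (lt_trans st tt)).
  + near=> u; rewrite /= in_itv /=; apply/andP; split.
      by apply: le_trans s0 _; near: u; exact: nbhs_right_ge.
    by near: u; apply: nbhs_right_le; exact: lt_trans tt.
  (* As [s < tau] strictly, every [u] near [s] satisfies [u < tau], so Kolmogorov-Chapman applies to
     [u], [tau], [t]. *)
  + near=> u; rewrite /= !in_itv /= => /andP[u0 _].
    have ut : u < tau by near: u; exact: lt_nbhsl.
    by rewrite u0 ltW//; split=> //; exact: FA.
  + by move=> ijk; apply: (dM _ _ s0 st).1.
- apply: (derive_in_linear _ _ _ (mu (M s tau)) `[tau, +oo[ `[s, +oo[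
    (fun u => M tau u) (fun u => M s u)).
  + by rewrite /= in_itv /= andbT (ltW (lt_trans st tt)).
  + near=> u; rewrite /= in_itv /= andbT.
    apply: le_trans (ltW (lt_trans st tt)) _.
    by near: u; exact: nbhs_right_ge.
  + near=> u; rewrite /= !in_itv /= !andbT => _.
    have tu : tau < u by near: u; exact: lt_nbhsr.
    by split; [exact: ltW|exact: FA].
  + by move=> ijk; apply: (dM _ _ (le_trans s0 (ltW st)) tt).2.
Unshelve. all: by end_near. Qed.
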